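(* (i) For every set $E\in\mathcal{E}$ and every perfect tree $T\subseteq 2^{<\omega}$ there is a perfect tree $T'\subseteq T$ such that for every $n\in\omega$, $E+\underbrace{[T']+[T']+\dots+[T']}_{n\text{ times}}\in\mathcal{E}$. (ii) For every set $E\in\mathcal{E}$ and every uniformly perfect tree $T\subseteq 2^{<\omega}$ there is a uniformly perfect tree $T'\subseteq T$ such that for every $n\in\omega$, $E+\underbrace{[T']+[T']+\dots+[T']}_{n\text{ times}}\in\mathcal{E}$.
   Context: $\mathcal{E}$ denotes the $\sigma$-ideal of subsets of $2^\omega$ generated by closed null sets, i.e. $E\in\mathcal{E}$ iff $E$ is contained in a countable union of closed subsets of $2^\omega$ of measure zero for the standard product (Haar) probability measure. A tree is a nonempty set $T\subseteq 2^{<\omega}$ closed under initial segments. Write $\mathrm{split}(T)=\{\sigma\in T:\sigma^\frown 0\in T\text{ and }\sigma^\frown 1\in T\}$ and $[T]=\{x\in 2^\omega:(\forall n\in\omega)\ x\upharpoonright n\in T\}$. $T$ is perfect if for every $\sigma\in T$ there is $\tau\in\mathrm{split}(T)$ with $\sigma\subseteq\tau$. $T$ is uniformly perfect if it is perfect and for every $n\in\omega$ either $2^n\cap T\subseteq\mathrm{split}(T)$ or $2^n\cap\mathrm{split}(T)=\emptyset$. On $2^\omega$, $+$ is coordinatewise addition modulo $2$, and $A+B=\{a+b:a\in A,\ b\in B\}$ for $A,B\subseteq 2^\omega$; for $n=0$ the displayed set is read as $E$ itself. *)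

(* Defs.v *)
From HB Require Import structures.
From mathcomp Require Import all_boot all_order all_algebra.
From mathcomp Require Import all_classical all_reals all_analysis.
From mathcomp Require Import zify ring lra.

Set Implicit Arguments.
Unset Strict Implicit.
Unset Printing Implicit Defensive.

Import Order.TTheory GRing.Theory Num.Theory.
Import numFieldNormedType.Exports.

Local Open Scope classical_set_scope.
Local Open Scope ring_scope.

Definition restr (x : cantor_space) (n : nat) : seq bool := mkseq x n.

Definition cylinder (s : seq bool) : set cantor_space :=
  [set x | restr x (size s) = s].

Notation cantor_borel := (g_sigma_algebraType (@open cantor_space)).

(* Digit n of x in [0, 1[ has weight 2 ^- n.+1, and digit sequences that are
   eventually 1 do not occur. *)
Definition binary_digits (R : realType) (x : R) : cantor_borel :=
  fun n => odd (Num.truncn (x * 2 ^+ n.+1)).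

Lemma size_restr x n : size (restr x n) = n.
Proof. exact: size_mkseq. Qed.

Lemma restr_eqP (x y : cantor_space) n :
  restr x n = restr y n <-> forall i, (i < n)%N -> x i = y i.
Proof.
split=> [/(congr1 (fun s => nth false s)) e i lin|e].
  by have := congr1 (fun f => f i) e; rewrite !nth_mkseq.
by apply/eq_in_map => i; rewrite mem_iota => /andP[_]; exact: e.
Qed.

Lemma cylinder_restr (x y : cantor_space) n :
  cylinder (restr x n) y <-> forall i, (i < n)%N -> y i = x i.
Proof. by rewrite /cylinder; cbn beta; rewrite size_restr; exact: restr_eqP. Qed.

Lemma open_cylinder (U : set cantor_space) (x : cantor_space) :
  open U -> U x -> exists n, cylinder (restr x n) `<=` U.
Proof.
move=> oU Ux.
pose F := filter_from setT (fun n => cylinder (restr x n)).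
have FF : Filter F.
  apply: filter_from_filter; first by exists 0%N.
  move=> i j _ _; exists (maxn i j) => // y /cylinder_restr e.
  split; apply/cylinder_restr => k lk; apply: e.
    by rewrite leq_max lk.
  by rewrite leq_max lk orbT.
suff : F --> x by move=> /(_ U (open_nbhs_nbhs (conj oU Ux))) [n _ nU]; exists n.
apply/cvg_sup => i V [W [[B oB <-] Bx] BV].
exists i.+1 => // y /cylinder_restr e.
by apply: BV => /=; rewrite /proj /= e//; exact: Bx.
Qed.

Section coin_measure.
Context (R : realType).

Lemma measurable_binary_digits : measurable_fun setT (@binary_digits R).
Proof.
apply: (@measurability _ _ _ cantor_borel _ _ (@open cantor_space)) => // _ [U oU <-].
rewrite setTI.
have mdig n : measurable_fun setT (fun x : R => binary_digits x n).
  apply: (measurable_fun_bool true) => //; rewrite setTI.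
  have -> : (fun x : R => binary_digits x n) @^-1` [set true] =
    \bigcup_(k in [set k | odd k])
      [set` `[k%:R / 2 ^+ n.+1, k.+1%:R / 2 ^+ n.+1[%R].
    have p2 : 0 < 2 ^+ n.+1 :> R by rewrite exprn_gt0.
    apply/seteqP; split=> x; rewrite /binary_digits /=.
      set k := Num.truncn _ => ok; exists k => //=.
      rewrite in_itv /= ler_pdivrMr// ltr_pdivlMr//.
      apply: truncn_itv; apply: (le_trans ler01); rewrite -truncn_gt0 -/k.
      exact: odd_gt0.
    case=> k /= ok; rewrite in_itv /= ler_pdivrMr// ltr_pdivlMr// => H.
    by rewrite (truncn_def H).
  by apply: bigcup_measurable => k _; exact: measurable_itv.
have mcyl s : measurable (@binary_digits R @^-1` cylinder s).
  have -> : @binary_digits R @^-1` cylinder s =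
    \bigcap_(i in [set k | (k < size s)%N])
      ((fun x => binary_digits x i) @^-1` [set nth false s i]).
    apply/seteqP; split=> x; rewrite /cylinder /=.
      by move=> e i /= il; rewrite -e nth_mkseq.
    move=> e; apply: (@eq_from_nth _ false); rewrite size_restr// => i il.
    by rewrite nth_mkseq// e.
  apply: fin_bigcap_measurable; first exact: finite_II.
  by move=> k _; rewrite -[X in measurable X]setTI; exact: mdig.
have -> : @binary_digits R @^-1` U =
  \bigcup_s (if `[< cylinder s `<=` U >]
    then @binary_digits R @^-1` cylinder s else set0).
  apply/seteqP; split=> x /=; last by case=> s _; case: asboolP => // sU /sU.
  move=> /(open_cylinder oU)[n nU]; exists (restr (binary_digits x) n) => //.
  by case: asboolP => // _; exact/cylinder_restr.
apply: countable_bigcupT_measurable => [|s]; first exact: countableP.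
by case: ifP.
Qed.

(* The standard product measure on bool ^ nat, as the law of the binary digits
   of a uniform point of [0, 1[.  It is the product measure because it gives
   each cylinder of length n the mass 2 ^- n (coin_measure_cylinder), and the
   cylinders and set0 form a pi-system generating the Borel sets. *)
Definition coin_measure : set cantor_borel -> \bar R :=
  pushforward (mrestr lebesgue_measure (measurable_itv `[0, 1[%R))
    (@binary_digits R).

Let coin_measure0 : coin_measure set0 = 0%E.
Proof. by rewrite /coin_measure /pushforward preimage_set0 measure0. Qed.

Let coin_measure_ge0 A : (0 <= coin_measure A)%E.
Proof. by rewrite /coin_measure /pushforward measure_ge0. Qed.

Let coin_measure_sigma_additive : semi_sigma_additive coin_measure.
Proof.
move: (measurable_binary_digits) => mf.
exact: (@measure_semi_sigma_additive _ _ _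
  (pushforward (mrestr lebesgue_measure (measurable_itv `[0, 1[%R)) _)).
Qed.

HB.instance Definition _ := isMeasure.Build _ _ _ coin_measure
  coin_measure0 coin_measure_ge0 coin_measure_sigma_additive.

Let truncn_double (y : R) : 0 <= y ->
  (Num.truncn (y * 2))./2 = Num.truncn y.
Proof.
move=> y0; apply/esym/truncn_def.
have /truncn_itv : 0 <= y * 2 by rewrite mulr_ge0.
set k := Num.truncn _ => /andP[k1 k2].
have : k%:R = (odd k)%:R + (k./2)%:R * 2 :> R.
  by rewrite -natrM -natrD muln2 odd_double_half.
move: k1 k2; rewrite -!natr1; case: (odd k) => /= k1 k2 e; apply/andP; split; lra.
Qed.

Let bin_val (s : seq bool) : nat := foldl (fun m (b : bool) => b + m.*2)%N 0%N s.

Let bin_val_lt s : (bin_val s < 2 ^ size s)%N.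
Proof.
elim/last_ind: s => // s b; rewrite /bin_val foldl_rcons size_rcons expnS.
rewrite -/(bin_val s) mul2n -!muln2; case: b; lia.
Qed.

Let restr_binary_digits (x : R) s : 0 <= x < 1 ->
  restr (binary_digits x) (size s) = s <->
  Num.truncn (x * 2 ^+ size s) = bin_val s.
Proof.
move=> /andP[x0 x1]; elim/last_ind: s => [|s b IHs].
  by split=> // _; rewrite expr0 mulr1; apply: truncn_def; rewrite x0.
rewrite size_rcons /restr mkseqS -/(restr _ _) /bin_val foldl_rcons -/(bin_val s).
have := @truncn_double (x * 2 ^+ size s); rewrite -mulrA -exprSr.
rewrite mulr_ge0 ?exprn_ge0// => /(_ isT).
rewrite {2}/binary_digits; set k := Num.truncn (_ * _ ^+ _.+1) => kh; split.
  move=> /rcons_inj[/IHs e1 e2].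
  by rewrite -(odd_double_half k) kh e1 e2.
move=> e; congr rcons; last by rewrite e oddD odd_double addbF oddb.
by apply/IHs; rewrite -kh e half_bit_double.
Qed.

Lemma coin_measure_cylinder s : coin_measure (cylinder s) = (2 ^- size s)%:E.
Proof.
have p2 : 0 < 2 ^+ size s :> R by rewrite exprn_gt0.
rewrite /coin_measure /pushforward /mrestr.
set A := _ `&` _.
have -> : A = [set` `[(bin_val s)%:R / 2 ^+ size s,
                      (bin_val s).+1%:R / 2 ^+ size s[%R].
  apply/seteqP; split=> x; rewrite /A /= in_itv /= in_itv /=.
    move=> [/[swap] x01 /(restr_binary_digits _ x01) <-].
    rewrite ler_pdivrMr// ltr_pdivlMr//; apply: truncn_itv.
    by case/andP: x01 => x0 _; rewrite mulr_ge0// ltW.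
  rewrite ler_pdivrMr// ltr_pdivlMr// => H.
  have x01 : 0 <= x < 1.
    case/andP: H => H1 H2; apply/andP; split.
      by rewrite -(pmulr_lge0 _ p2) (le_trans _ H1).
    rewrite -(ltr_pM2r p2) mul1r (lt_le_trans H2)//.
    by rewrite -natrX ler_nat; exact: bin_val_lt.
  by split=> //; apply/(restr_binary_digits _ x01)/truncn_def.
rewrite lebesgue_measure_itv /= lte_fin ltr_pM2r ?invr_gt0// ltr_nat ltnSn.
by rewrite -EFinB -mulrBl -natrB// subSnn mul1r.
Qed.

Let coin_measureT : coin_measure setT = 1%E.
Proof.
have <- : cylinder [::] = setT by apply/seteqP.
by rewrite coin_measure_cylinder expr0 invr1.
Qed.

HB.instance Definition _ :=
  Measure_isProbability.Build _ _ _ coin_measure coin_measureT.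

End coin_measure.

Definition in_calE (R : realType) (E : set cantor_space) : Prop :=
  exists F : (set cantor_space)^nat,
    (forall k, closed (F k) /\ coin_measure R (F k) = 0%E) /\
    E `<=` \bigcup_k F k.

Definition is_tree (T : set (seq bool)) : Prop :=
  T !=set0 /\ forall s t, T s -> prefix t s -> T t.

Definition split_nodes (T : set (seq bool)) : set (seq bool) :=
  [set s | [/\ T s, T (rcons s false) & T (rcons s true)]].

Definition branches (T : set (seq bool)) : set cantor_space :=
  [set x | forall n, T (restr x n)].

Definition perfect_tree (T : set (seq bool)) : Prop :=
  is_tree T /\ forall s, T s -> exists2 t, split_nodes T t & prefix s t.

Definition level (n : nat) : set (seq bool) := [set s | size s = n].

Definition uniformly_perfect_tree (T : set (seq bool)) : Prop :=
  perfect_tree T /\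
  forall n, level n `&` T `<=` split_nodes T \/ level n `&` split_nodes T = set0.

Definition cantor_add (x y : cantor_space) : cantor_space :=
  fun n => x n (+) y n.

Definition sumset (A B : set cantor_space) : set cantor_space :=
  [set cantor_add a b | a in A & b in B].

(* E + B + ... + B with n summands B; it is E itself for n = 0. *)
Definition sumset_iter (E B : set cantor_space) (n : nat) : set cantor_space :=
  iter n (fun A => sumset A B) E.

(* Main.v *)
Require Import Defs.
From mathcomp Require Import all_boot all_order all_algebra.
From mathcomp Require Import all_classical all_reals all_analysis.
From mathcomp Require Import zify.

(** One thinning of the tree serves both parts.  Cut the levels into blocks
    [L i, L i.+1[ and let [thin L T] keep, along each branch and inside each
    block, only the first splitting node of T; at later splitting nodes of the
    same block only the false-child survives.

    Branches of the thinned tree make at most one free choice per block, so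
    there are at most 2 ^ m nodes at level L m, whatever T is
    ([card_traces_thin]).  On the other hand, by continuity from above, a closed
    null set F meets only a vanishing proportion of the cylinders of length n as
    n grows ([closed_null_traces]).  If E is covered by closed null sets F k, the
    boundaries L m can therefore be chosen so sparse that for m >= k the traces
    of F k at level L m have proportion at most 2 ^ - (m + m * m).  Adding n
    copies of the branches multiplies the number of traces by at most
    2 ^ (m * n), so for m >= n the proportion of traces of
    F k + [T'] + ... + [T'] is still at most 2 ^ - m.  A set whose traces have
    arbitrarily small proportion lies in a closed null set, namely the
    intersection of its cylinder hulls ([traces_closed_null]), and the union over
    k covers E + [T'] + ... + [T'].

    Thinning preserves perfectness because beyond each block boundary the next
    splitting node of T is kept ([thin_perfect]), and it preserves uniformity
    because, when splitting depends on the level only, so does being the first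
    splitting level of a block ([thin_uniformly_perfect]). *)

Import Order.TTheory GRing.Theory Num.Theory.
Local Open Scope classical_set_scope.

Set Implicit Arguments.
Unset Strict Implicit.
Unset Printing Implicit Defensive.

(** * Traces of a set on a finite level *)

Lemma restr_take (x : cantor_space) (m n : nat) :
  (m <= n)%N -> take m (restr x n) = restr x m.
Proof.
by move=> mn; rewrite /restr /mkseq -map_take take_iota (minn_idPl mn).
Qed.

Lemma nbhs_cylinder (x : cantor_space) (n : nat) :
  nbhs x (cylinder (restr x n)).
Proof.
elim: n => [|n IHn]; first by apply: (filterS _ filterT) => y _; exact/cylinder_restr.
have Vn : nbhs x [set y : cantor_space | y n = x n].
  apply: (@proj_continuous nat (fun=> bool) n x [set x n]).
  by apply: open_nbhs_nbhs; split=> //; exact: discrete_open.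
apply: filterS (filterI IHn Vn) => y [/cylinder_restr e en].
apply/cylinder_restr => i; rewrite ltnS leq_eqVlt => /predU1P[->//|]; exact: e.
Qed.

Lemma open_restr (n : nat) (P : set (seq bool)) :
  open [set x : cantor_space | P (restr x n)].
Proof.
rewrite openE => x Px; apply: filterS (nbhs_cylinder x n) => y /=.
by rewrite /cylinder /= size_restr => ->.
Qed.

Lemma closed_restr (n : nat) (P : set (seq bool)) :
  closed [set x : cantor_space | P (restr x n)].
Proof. by rewrite -[X in closed X]setCK; apply: open_closedC; exact: (@open_restr n (~` P)). Qed.

Definition traces (n : nat) (A : set cantor_space) : {set n.-tuple bool} :=
  finset (fun t : n.-tuple bool => `[< exists2 x, A x & restr x n = t >]).

Lemma tracesP (n : nat) (A : set cantor_space) (t : n.-tuple bool) :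
  reflect (exists2 x, A x & restr x n = t) (t \in traces n A).
Proof. by rewrite inE; exact: asboolP. Qed.

(** The union of the cylinders of length n that meet A. *)
Definition hull (n : nat) (A : set cantor_space) : set cantor_space :=
  [set x | exists2 y, A y & restr y n = restr x n].

Lemma sub_hull (n : nat) (A : set cantor_space) : A `<=` hull n A.
Proof. by move=> x Ax; exists x. Qed.

Lemma closed_hull (n : nat) (A : set cantor_space) : closed (hull n A).
Proof. exact: (@closed_restr n [set s | exists2 y, A y & restr y n = s]). Qed.

Lemma measurable_restr (n : nat) (P : set (seq bool)) :
  measurable ([set x | P (restr x n)] : set cantor_borel).
Proof. by apply: sub_sigma_algebra; exact: open_restr. Qed.

Lemma measurable_hull (n : nat) (A : set cantor_space) :
  measurable (hull n A : set cantor_borel).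
Proof. exact: (@measurable_restr n [set s | exists2 y, A y & restr y n = s]). Qed.

(** A point outside a closed set has a whole cylinder outside it. *)
Lemma bigcap_hull (A : set cantor_space) : closed A -> \bigcap_n hull n A `<=` A.
Proof.
move=> cA x Hx; apply: contrapT => nAx.
have [n nA] := open_cylinder (closed_openC cA) nAx.
have [y Ay e] := Hx n I.
by apply: (nA y) => //; rewrite /cylinder /= size_restr.
Qed.

Lemma hull_mono (m n : nat) (A : set cantor_space) :
  (m <= n)%N -> hull n A `<=` hull m A.
Proof.
move=> mn x [y Ay e]; exists y => //.
by rewrite -(restr_take y mn) e restr_take.
Qed.

(** * Null closed sets and the proportion of traces *)

Section measure.
Context (R : realType).
Local Notation mu := (@coin_measure R).
Local Open Scope ring_scope.

Lemma coin_measure_hull (n : nat) (A : set cantor_space) :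
  mu (hull n A) = (#|traces n A|%:R / 2 ^+ n)%:E.
Proof.
have -> : hull n A = \bigcup_(t in [set` enum (traces n A)]) cylinder (tval t).
  apply/seteqP; split=> x.
    move=> [y Ay e]; have sx : size (restr x n) == n by rewrite size_restr.
    exists (Tuple sx); last by exact/cylinder_restr.
    by rewrite /= mem_enum; apply/tracesP; exists y.
  move=> [t /=]; rewrite mem_enum => /tracesP[y Ay e].
  by rewrite /cylinder /= size_tuple -e => e'; exists y.
rewrite measure_fin_bigcup.
- rewrite -fsbig_seq ?enum_uniq// big_enum /=.
  under eq_bigr => t _ do rewrite coin_measure_cylinder size_tuple.
  by rewrite sumEFin sumr_const mulr_natl.
- exact: finite_seq.
- move=> s t _ _ [x []]; rewrite /cylinder /= !size_tuple => es et.
  by apply: val_inj; rewrite /= -es -et.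
- move=> t _; exact: (@measurable_restr (size t) [set s | s = tval t]).
Qed.

(** The hulls of F decrease to F, so their measures, which are the proportions of
    traces, tend to 0. *)
Lemma closed_null_traces (F : set cantor_space) (k : nat) :
  closed F -> mu F = 0%E ->
  exists n0, forall n, (n0 <= n)%N -> (2 ^ k * #|traces n F| <= 2 ^ n)%N.
Proof.
move=> cF F0.
have EF : \bigcap_n hull n F = F.
  by apply/seteqP; split; [exact: bigcap_hull|move=> x Fx n _; exact: sub_hull].
have fin : (mu (hull 0 F) < +oo)%E by rewrite coin_measure_hull ltry.
have : mu \o (fun n => hull n F) @ \oo --> mu (\bigcap_n hull n F).
  apply: nonincreasing_cvg_mu.
  - exact: fin.
  - by move=> n; exact: measurable_hull.
  - by apply: bigcap_measurable => // n _; exact: measurable_hull.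
  - by move=> m n mn; apply/subsetPset; exact: hull_mono.
rewrite EF F0 => cv.
have p2 n : 0 < 2 ^+ n :> R by rewrite exprn_gt0.
have : \forall n \near \oo, (mu (hull n F) < (2 ^- k)%:E)%E.
  have : nbhs 0%:E [set x : \bar R | (x < (2 ^- k)%:E)%E].
    apply: open_nbhs_nbhs; split; first exact: open_ereal_lt_ereal.
    by rewrite /= lte_fin invr_gt0.
  exact: cv.
case=> n0 _ H; exists n0 => n /H /=.
rewrite coin_measure_hull lte_fin ltr_pdivrMr// mulrC ltr_pdivlMr//.
by rewrite mulrC -!natrX -natrM ltr_nat => /ltnW.
Qed.

(** The intersection of the hulls is closed, and null since each hull bounds its
    measure.  Taking it spares proving that sums of closed sets are closed. *)
Lemma traces_closed_null (A : set cantor_space) :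
  (forall k, exists n, (2 ^ k * #|traces n A| <= 2 ^ n)%N) ->
  exists C, [/\ closed C, mu C = 0%E & A `<=` C].
Proof.
move=> small; exists (\bigcap_n hull n A); split.
- by apply: closed_bigI => n _; exact: closed_hull.
- have mC : measurable (\bigcap_n hull n A : set cantor_borel).
    by apply: bigcap_measurable => // n _; exact: measurable_hull.
  apply/eqP; rewrite eq_le measure_ge0 andbT; apply/lee_addgt0Pr => e e0.
  rewrite add0e.
  have p2 n : 0 < 2 ^+ n :> R by rewrite exprn_gt0.
  have [k ke] : exists k : nat, 2 ^- k < e.
    exists (Num.bound e^-1); rewrite invf_plt ?posrE//.
    apply: (lt_le_trans (archi_boundP _)); first by rewrite invr_ge0 ltW.
    by rewrite -natrX ler_nat ltnW// ltn_expl.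
  have [n hn] := small k.
  apply: (@le_trans _ _ (mu (hull n A))).
    by apply: le_measure; rewrite ?inE//; [exact: measurable_hull|exact: bigcap_inf].
  rewrite coin_measure_hull lee_fin; apply: le_trans (ltW ke).
  rewrite ler_pdivrMr// mulrC ler_pdivlMr// mulrC.
  by rewrite -!natrX -natrM ler_nat.
- by move=> x Ax n _; exact: sub_hull.
Qed.
End measure.

(** * Traces of sums *)

(** Digits are added without carry, so a trace of a + b is determined by the
    traces of a and b at the same level. *)
Lemma card_traces_sumset (n : nat) (A B : set cantor_space) :
  (#|traces n (sumset A B)| <= #|traces n A| * #|traces n B|)%N.
Proof.
pose add (s t : n.-tuple bool) : n.-tuple bool :=
  [tuple tnth s i (+) tnth t i | i < n].
rewrite -cardsX.
apply: (leq_trans _ (leq_imset_card (fun p => add p.1 p.2) _)).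
apply/subset_leq_card/fintype.subsetP => t /tracesP[_ [a Aa [b Bb <-]] e].
have sz (x : cantor_space) : size (restr x n) == n by rewrite size_restr.
apply/imsetP; exists (Tuple (sz a), Tuple (sz b)).
  by rewrite finset.in_setX; apply/andP; split; apply/tracesP; [exists a|exists b].
apply: eq_from_tnth => i; rewrite tnth_mktuple !(tnth_nth false) -e /=.
by rewrite !nth_mkseq.
Qed.

Lemma card_traces_sumset_iter (n k : nat) (A B : set cantor_space) :
  (#|traces n (sumset_iter A B k)| <= #|traces n A| * #|traces n B| ^ k)%N.
Proof.
elim: k => [|k IHk]; first by rewrite muln1.
apply: leq_trans (card_traces_sumset _ _ _) _.
by rewrite expnSr mulnA leq_mul2r IHk orbT.
Qed.

Lemma sumset_iter_bigcup (F : (set cantor_space)^nat) (E B : set cantor_space)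
    (n : nat) :
  E `<=` \bigcup_k F k -> sumset_iter E B n `<=` \bigcup_k sumset_iter (F k) B n.
Proof.
move=> EF; elim: n => [//|n IHn] _ [a /IHn[k _ Ha] [b Bb <-]].
by exists k => //; exists a => //; exists b.
Qed.

(** * Thinning a tree *)

(** For i < j, no block boundary L b separates level i from level j. *)
Definition same_block (L : nat -> nat) (i j : nat) : Prop :=
  forall b, ~~ (i < L b <= j)%N.

(** In each block a node may turn to the true-child at a splitting node of T only
    if it met no earlier splitting node of T in that block.  Turning to the
    false-child is always allowed, so that no node of the thinned tree is dead. *)
Definition thin (L : nat -> nat) (T : set (seq bool)) : set (seq bool) :=
  [set s | T s /\ forall i j, (i < j < size s)%N -> same_block L i j ->
     split_nodes T (take i s) -> split_nodes T (take j s) ->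
     nth false s j = false].

Lemma thin_sub (L : nat -> nat) (T : set (seq bool)) : thin L T `<=` T.
Proof. by move=> s []. Qed.

Lemma thin_prefix (L : nat -> nat) (T : set (seq bool)) (s t : seq bool) :
  is_tree T -> thin L T s -> prefix t s -> thin L T t.
Proof.
move=> [_ treeT] [Ts Hs] ts; split; first exact: treeT ts.
move: ts Hs => /prefixP[u ->] Hs i j /andP[ij jt] ijL.
move/(_ i j): Hs; rewrite size_cat ij ltn_addr// => /(_ isT ijL).
by rewrite !takel_cat ?nth_cat ?jt// ltnW// (ltn_trans ij).
Qed.

Lemma thin_tree (L : nat -> nat) (T : set (seq bool)) :
  is_tree T -> is_tree (thin L T).
Proof.
move=> treeT; split; last by move=> s t; exact: thin_prefix.
case: (treeT) => -[s Ts] /(_ _ _ Ts (prefix0s s)) T0.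
by exists [::]; split=> // i j; rewrite ltn0 andbF.
Qed.

(** The hypothesis on c is the thinning condition at the last digit; the earlier
    digits are constrained by s alone. *)
Lemma thin_rcons (L : nat -> nat) (T : set (seq bool)) (s : seq bool) (c : bool) :
  thin L T s -> T (rcons s c) ->
  (forall i, (i < size s)%N -> same_block L i (size s) ->
     split_nodes T (take i s) -> split_nodes T s -> c = false) ->
  thin L T (rcons s c).
Proof.
move=> [Ts Hs] Tsc Hc; split=> // i j; rewrite size_rcons ltnS => /andP[ij js] ijL.
move: js; rewrite leq_eqVlt => /predU1P[ej|js]; last first.
  by rewrite nth_rcons js -!cats1 !takel_cat ?(ltnW js) ?(ltnW (ltn_trans ij js))//;
    apply: Hs; rewrite ?ij.
rewrite ej nth_rcons ltnn eqxx -!cats1 takel_cat; last by rewrite -ej ltnW.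
by rewrite takel_cat// take_size; rewrite ej in ij ijL; exact: Hc.
Qed.

Lemma thin_extend1 (L : nat -> nat) (T : set (seq bool)) (s : seq bool) :
  perfect_tree T -> thin L T s -> exists c, thin L T (rcons s c).
Proof.
move=> [[_ treeT] perfT] Ts.
have [Tf|nTf] := pselect (T (rcons s false)).
  by exists false; exact: thin_rcons.
have [t [Tt Ttf _] /prefixP[u eu]] := perfT _ (thin_sub Ts).
exists true; apply: thin_rcons => //; last by move=> i _ _ _ [].
case: u eu => [|c u] eu; first by case: nTf; rewrite -[s]cats0 -eu.
have : T (rcons s c) by apply: treeT Tt _; rewrite eu -cat_rcons prefix_prefix.
by case: c {eu}.
Qed.

Lemma thin_extend (L : nat -> nat) (T : set (seq bool)) (s : seq bool) (n : nat) :
  perfect_tree T -> thin L T s -> (size s <= n)%N ->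
  exists t, [/\ thin L T t, prefix s t & size t = n].
Proof.
move=> perfT Ts /subnK <-; elim: (n - size s)%N => [|k [t [Tt st szt]]].
  by exists s; rewrite prefix_refl.
have [c Tc] := thin_extend1 perfT Tt.
exists (rcons t c); rewrite size_rcons szt; split=> //.
by apply: prefix_trans st _; rewrite -cats1 prefix_prefix.
Qed.

(** Extend the given node up to a block boundary; from there the nearest splitting
    node of T is the first one in its block, so both its children survive. *)
Lemma thin_perfect (L : nat -> nat) (T : set (seq bool)) :
  (forall n, (n <= L n)%N) -> perfect_tree T -> perfect_tree (thin L T).
Proof.
move=> leL perfT; have [treeT splitT] := perfT.
split=> [|s Ts]; first exact: thin_tree.
have [t [Tt st szt]] := thin_extend perfT Ts (leL (size s)).
(* u is a shortest splitting node above t *)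
pose Q n := `[< exists u, [/\ split_nodes T u, prefix t u & size u = n] >].
have exQ : exists n, Q n.
  by have [u Su tu] := splitT _ (thin_sub Tt); exists (size u); apply/asboolP; exists u.
case: (ex_minnP exQ) => _ /asboolP[u [Su tu <-]] minu.
have [v eu] := prefixP tu.
have early k : (k < size u)%N -> split_nodes T (take k u) -> (k < size t)%N.
  move=> ku Sk; rewrite ltnNge; apply/negP => tk.
  suff : (size u <= k)%N by rewrite leqNgt ku.
  apply: minu; apply/asboolP; exists (take k u); rewrite size_takel ?(ltnW ku)//.
  by split=> //; rewrite eu take_cat ltnNge tk prefix_prefix.
have Tu : thin L T u.
  split; first by case: Su.
  move=> i j /andP[ij ju] ijL Si Sj; have jt := early _ ju Sj.
  move: Si Sj; rewrite eu nth_cat jt !takel_cat ?(ltnW jt) ?(ltnW (ltn_trans ij jt))//.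
  by case: Tt => _; apply; rewrite ?ij.
have Tuc c : T (rcons u c) -> thin L T (rcons u c).
  move=> Tc; apply: thin_rcons => // i iu iL Si _.
  have := iL (size s); rewrite -szt (early _ iu Si) eu size_cat leq_addr.
  by move=> /negP[].
by exists u; [case: Su => _ Tf Tt'; split=> //; exact: Tuc|exact: prefix_trans tu].
Qed.

(** At a level where T splits, the thinned tree splits at all nodes or at none,
    according to whether an earlier level of the same block is splitting. *)
Lemma thin_uniformly_perfect (L : nat -> nat) (T : set (seq bool)) :
  (forall n, (n <= L n)%N) -> uniformly_perfect_tree T ->
  uniformly_perfect_tree (thin L T).
Proof.
move=> leL [perfT unifT]; split=> [|n]; first exact: thin_perfect.
have [treeT _] := perfT.
have Ttake k s : thin L T s -> T (take k s).
  by move=> /thin_sub Ts; case: treeT => _ /(_ _ _ Ts); apply; exact: prefix_take.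
have [allS|noS] := unifT n; last first.
  right; rewrite -subset0 -noS => s [sn [Ts Tf Tt]].
  by split=> //; split; [move: Ts|move: Tf|move: Tt]; exact: thin_sub.
have [[i [lin iL Si]]|free] := pselect (exists i,
    [/\ (i < n)%N, same_block L i n & level i `&` T `<=` split_nodes T]).
  right; rewrite -subset0 => s [/= sn [Ts _ Tt]].
  have szi : size (take i s) = i by rewrite size_takel// sn ltnW.
  case: Tt => _ /(_ i n); rewrite size_rcons sn lin ltnSn => /(_ isT iL).
  rewrite -cats1 !takel_cat ?sn ?(ltnW lin)// nth_cat sn ltnn subnn /=.
  have Ssi : split_nodes T (take i s) by apply: Si; split=> //; exact: Ttake.
  have Ss : split_nodes T (take n s).
    by apply: allS; split; [rewrite /level /= size_takel ?sn|exact: Ttake].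
  by move=> /(_ Ssi Ss).
left=> s [/= sn Ts].
have [_ Tf Tt] : split_nodes T s by apply: allS; split=> //; exact: thin_sub Ts.
have Tc c : T (rcons s c) -> thin L T (rcons s c).
  move=> Tsc; apply: thin_rcons => // i; rewrite sn => lin iL Si _.
  case: free; exists i; split=> //; have [//|noi] := unifT i.
  have : (level i `&` split_nodes T) (take i s).
    by split=> //; rewrite /level /= size_takel// sn ltnW.
  by rewrite noi.
by split=> //; exact: Tc.
Qed.

Lemma split_nodes_diverge (T : set (seq bool)) (s t : seq bool) (j : nat) :
  is_tree T -> T s -> T t -> (j < size s)%N -> (j < size t)%N ->
  take j s = take j t -> nth false s j != nth false t j -> split_nodes T (take j s).
Proof.
move=> [_ treeT] Ts Tt js jt e ne.
have hs : T (rcons (take j s) (nth false s j)).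
  by rewrite -take_nth//; apply: treeT Ts (prefix_take _ _).
have ht : T (rcons (take j s) (nth false t j)).
  by rewrite e -take_nth//; apply: treeT Tt (prefix_take _ _).
split; first by apply: treeT Ts (prefix_take _ _).
  by move: hs ht ne; case: nth => //; case: nth.
by move: hs ht ne; case: nth => //; case: nth.
Qed.

(** A node of length L m is determined by m bits, the i-th telling whether it
    turns to the true-child at some splitting node of T in block i.  If s and t
    diverge at level j, in block i, with s turning to the true-child, then s met
    no splitting node earlier in the block; so the common part gives t no such
    turn before j, and t cannot make one later in the block either, because
    take j t is already a splitting node of T. *)
Lemma card_traces_thin (L : nat -> nat) (T : set (seq bool)) (m : nat) :
  L 0 = 0%N -> {homo L : i j / (i <= j)%N} -> is_tree T ->
  (#|traces (L m) (branches (thin L T))| <= 2 ^ m)%N.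
Proof.
move=> L0 homoL treeT.
pose code (t : (L m).-tuple bool) : {ffun 'I_m -> bool} :=
  [ffun i : 'I_m => `[< exists p, [/\ (L i <= p < L i.+1)%N,
     split_nodes T (take p t) & nth false t p] >]].
have -> : (2 ^ m = #|{: {ffun 'I_m -> bool}}|)%N.
  by rewrite card_ffun card_bool card_ord.
apply: (@leq_card_in _ _ code).
have thinP t : t \in traces (L m) (branches (thin L T)) -> thin L T t.
  by case/tracesP => x /(_ (L m)) Tx <-.
suff sep (s t : (L m).-tuple bool) (j : nat) : thin L T s -> thin L T t ->
    (j < L m)%N -> take j s = take j t ->
    nth false s j = true -> nth false t j = false -> code s <> code t.
  move=> s t /thinP Ts /thinP Tt est; apply/eqP; apply: contraT => nst.
  have ex : exists j, nth false s j != nth false t j.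
    apply: contrapT => ne; case/eqP: nst; apply: val_inj.
    apply: (@eq_from_nth _ false) => [|j _]; first by rewrite !size_tuple.
    by apply/eqP; apply: contraT => nj; case: ne; exists j.
  case: (ex_minnP ex) => j nj minj.
  have jm : (j < L m)%N.
    by rewrite ltnNge; apply/negP => mj; rewrite !nth_default ?size_tuple// in nj.
  have e : take j s = take j t.
    apply: (@eq_from_nth _ false); rewrite !size_takel ?size_tuple ?(ltnW jm)// => i ij.
    rewrite !nth_take//; apply/eqP; apply: contraT => /minj.
    by rewrite leqNgt ij.
  case sj: (nth false s j) nj; case tj: (nth false t j) => // _.
    by have := sep _ _ _ Ts Tt jm e sj tj.
  by have := sep _ _ _ Tt Ts jm (esym e) tj sj; rewrite est.
move=> Ts Tt jm e sj tj.
have js : (j < size s)%N by rewrite size_tuple.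
have jt : (j < size t)%N by rewrite size_tuple.
have Sj : split_nodes T (take j s).
  by apply: (split_nodes_diverge treeT (thin_sub Ts) (thin_sub Tt)); rewrite ?sj ?tj.
have [i im /andP[ij ji]] : exists2 i, (i < m)%N & (L i <= j < L i.+1)%N.
  elim: m jm {Ts Tt e sj tj js jt Sj s t thinP code} => [|k IHk]; first by rewrite L0.
  case: (ltnP j (L k)) => [/IHk[i ik H] _|kj jk]; last by exists k; rewrite ?kj.
  by exists i => //; exact: ltnW.
have block p q : (L i <= p)%N -> (q < L i.+1)%N -> same_block L p q.
  move=> ip qi b; apply/negP => /andP[pb bq].
  have [/homoL|/homoL] := leqP b i; lia.
move=> /ffunP/(_ (Ordinal im)); rewrite !ffunE /= => ec.
have : `[< exists p, [/\ (L i <= p < L i.+1)%N,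
     split_nodes T (take p t) & nth false t p] >].
  by rewrite -ec; apply/asboolP; exists j; rewrite ij ji.
move=> /asboolP[p [/andP[ip pi] Sp tp]].
have pt : (p < size t)%N.
  by rewrite ltnNge; apply/negP => /(nth_default false) tp0; rewrite tp0 in tp.
have [pj|jp|pj] := ltngtP p j; last by rewrite pj tj in tp.
  case: Ts => _ /(_ p j); rewrite pj js => /(_ isT (block _ _ ip ji)).
  have -> : take p s = take p t.
    by rewrite -(@take_takel _ p j s) ?e ?take_takel// ltnW.
  by move=> /(_ Sp Sj); rewrite sj.
case: Tt => _ /(_ j p); rewrite jp pt => /(_ isT (block _ _ ij pi)).
by rewrite -e => /(_ Sj Sp); rewrite tp.
Qed.

(** * Choice of the block boundaries *)

(** Bounding h k m.+1 for all k <= m.+1 simultaneously is what lets one sequence L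
    dominate the thresholds of countably many closed null sets. *)
Lemma block_levels (h : nat -> nat -> nat) :
  exists L : nat -> nat,
    [/\ L 0 = 0%N, {homo L : i j / (i <= j)%N}, forall n, (n <= L n)%N &
        forall k m, (k <= m.+1)%N -> (h k m.+1 <= L m.+1)%N].
Proof.
pose g m := (\sum_(k < m.+1) h k m)%N.
exists (fun m => \sum_(i < m) (g i.+1).+1)%N; split.
- by rewrite big_ord0.
- apply: homo_leq => // [i j k|i]; first exact: leq_trans.
  by rewrite big_ord_recr leq_addr.
- elim=> // n IHn; rewrite big_ord_recr /= addnS ltnS.
  exact: leq_trans IHn (leq_addr _ _).
- move=> k m km; rewrite big_ord_recr /=; apply: leq_trans (leq_addl _ _).
  have km' : (k < m.+2)%N by rewrite ltnS.
  by apply: leqW; rewrite /g (bigD1 (Ordinal km')) //= leq_addr.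
Qed.

(** The boundaries depend on E only, because the number of nodes of the thinned
    tree at level L m is bounded independently of T. *)
Lemma thin_sumset_in_calE (R : realType) (E : set cantor_space) :
  in_calE R E -> exists L : nat -> nat,
    (forall n, (n <= L n)%N) /\
    forall T, is_tree T -> forall n,
      in_calE R (sumset_iter E (branches (thin L T)) n).
Proof.
move=> [F [Fnull EF]].
(* m * m leaves room for n <= m summands with 2 ^ m traces each, and m for the
   proportion to tend to 0 *)
have small k m : exists n0, forall n, (n0 <= n)%N ->
    (2 ^ (m + m * m) * #|traces n (F k)| <= 2 ^ n)%N.
  by case: (Fnull k) => cF F0; exact: closed_null_traces F0.
pose h k := projT1 (choice (small k)).
have Hh k : forall m n, (h k m <= n)%N -> (2 ^ (m + m * m) * #|traces n (F k)| <= 2 ^ n)%N.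
  exact: projT2 (choice (small k)).
have [L [L0 homoL leL hL]] := block_levels h.
exists L; split=> // T treeT n; set B := branches _.
have cover k : exists C, [/\ closed C, coin_measure R C = 0%E &
    sumset_iter (F k) B n `<=` C].
  apply: traces_closed_null => j.
  (* m is positive as [block_levels] requires, and at least each of n, k, j *)
  pose m := (n + k + j).+1; exists (L m).
  have cB : (#|traces (L m) B| <= 2 ^ m)%N by exact: card_traces_thin.
  have km : (k <= m)%N by rewrite /m; lia.
  have hLm : (h k m <= L m)%N by exact: hL.
  apply: leq_trans (Hh k m _ hLm).
  apply: (@leq_trans (2 ^ j * (#|traces (L m) (F k)| * 2 ^ (m * n)))%N).
    rewrite leq_mul2l; apply/orP; right.
    apply: leq_trans (card_traces_sumset_iter _ _ _ _) _.
    rewrite leq_mul2l expnM; apply/orP; right.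
    by case: (n) => // n'; rewrite leq_exp2r.
  rewrite mulnCA mulnC -expnD leq_mul2r leq_exp2l// leq_add ?orbT//.
    by rewrite /m; lia.
  by rewrite leq_mul2l /m; lia.
have [C HC] := choice cover.
exists C; split=> [k|]; first by case: (HC k).
by apply: subset_trans (sumset_iter_bigcup EF) _ => x [k _ Hx]; exists k => //;
  case: (HC k) => _ _; apply.
Qed.

Theorem theorem21 (R : realType) :
  (forall (E : set cantor_space) (T : set (seq bool)),
     in_calE R E -> perfect_tree T ->
     exists T' : set (seq bool),
       [/\ perfect_tree T', T' `<=` T &
           forall n : nat, in_calE R (sumset_iter E (branches T') n)]) /\
  (forall (E : set cantor_space) (T : set (seq bool)),
     in_calE R E -> uniformly_perfect_tree T ->
     exists T' : set (seq bool),
       [/\ uniformly_perfect_tree T', T' `<=` T &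
           forall n : nat, in_calE R (sumset_iter E (branches T') n)]).
Proof.
split=> E T /thin_sumset_in_calE[L [leL EL]] PT; exists (thin L T).
  split; [exact: thin_perfect|exact: thin_sub|].
  by apply: EL; case: PT.
split; [exact: thin_uniformly_perfect|exact: thin_sub|].
by apply: EL; case: PT => -[].
Qed.
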